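(* For every $i\in\{0,\ldots,k-n\}$, the cone $C_i\subseteq\mathcal{F}_{n+1,2d}$ is closed (with respect to the Euclidean topology on the finite-dimensional real vector space $\mathcal{F}_{n+1,2d}$).
   Context: Let $n,d\geq 1$ be integers. $\mathcal{F}_{n+1,l}$ denotes the real vector space of real forms (homogeneous polynomials) of degree $l$ in the variables $X=(X_0,\ldots,X_n)$. Let $k=k(n,d):=\binom{n+d}{n}-1$, so $\dim\mathcal{F}_{n+1,d}=k+1$. Order the set $I_{n+1,d}:=\{\alpha\in\mathbb{N}_0^{n+1}: |\alpha|=d\}$ lexicographically in decreasing order as $\alpha_0,\ldots,\alpha_k$ (so $\alpha_0=(d,0,\ldots,0)$ and $\alpha_k=(0,\ldots,0,d)$), and set $m_j(X):=X^{\alpha_j}$ for $j=0,\ldots,k$. For a real symmetric matrix $A\in\mathrm{Sym}_{k+1}(\mathbb{R})$ let $q_A(Z):=ZAZ^t$ be the associated quadratic form in $Z=(Z_0,\ldots,Z_k)$, and let the Gram map $\mathcal{G}:\mathrm{Sym}_{k+1}(\mathbb{R})\to\mathcal{F}_{n+1,2d}$ be $\mathcal{G}(A):=q_A(m_0(X),\ldots,m_k(X))$. For $i\in\{0,\ldots,k-n\}$ let $H_i:=\{[z]\in\mathbb{P}^k(\mathbb{C}) : \exists x\in\mathbb{C}^{n+1}\text{ with }(z_0,\ldots,z_{n+i})=(m_0(x),\ldots,m_{n+i}(x))\}$, let $V_i$ be the Zariski closure of $H_i$ in $\mathbb{P}^k$, and let $V_i(\mathbb{R})$ denote its set of real points.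 Define the convex cone $C_i:=\{f\in\mathcal{F}_{n+1,2d} : \exists A\in\mathcal{G}^{-1}(f)\text{ such that } q_A(z)\geq 0 \text{ for all } [z]\in V_i(\mathbb{R})\}$ (the sign of $q_A(z)$ is independent of the representative $z$). *)

(* Defs.v *)
From HB Require Import structures.
From mathcomp Require Import all_boot all_order all_algebra.
From mathcomp Require Import all_classical all_reals all_analysis.
From mathcomp Require Import complex.
Unset Printing Implicit Defensive.
Import Order.TTheory GRing.Theory Num.Theory.
Local Open Scope ring_scope.

(* Exponent vectors (as seq nat of length v) of degree dg in v variables,
   listed in DECREASING lexicographic order. *)
Fixpoint mons (v dg : nat) : seq (seq nat) :=
  match v with
  | 0 => if dg == 0%N then [:: [::]] else [::]
  | v'.+1 => flatten [seq [seq a :: t | t <- mons v' (dg - a)]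
                     | a <- rev (iota 0 dg.+1)]
  end.

Definition kk (n d : nat) : nat := ('C(n + d, n)).-1.

Definition alpha (n d j : nat) : seq nat := nth [::] (mons n.+1 d) j.

Definition monom (K : comNzRingType) (v : nat) (a : seq nat) (x : 'rV[K]_v) : K :=
  \prod_(l < v) x ord0 l ^+ nth 0%N a l.

Definition mj (K : comNzRingType) (n d j : nat) (x : 'rV[K]_n.+1) : K :=
  monom K n.+1 (alpha n d j) x.

(* Space of real forms of degree 2d in n+1 variables, identified with
   coefficient vectors w.r.t. the monomial basis (beta_l)_l of I_{n+1,2d}. *)
Definition NF (n d : nat) : nat := size (mons n.+1 (2 * d)).
Definition beta (n d l : nat) : seq nat := nth [::] (mons n.+1 (2 * d)) l.

Definition addexp (a b : seq nat) : seq nat := [seq p.1 + p.2 | p <- zip a b]%N.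

(* Gram map: G(A) = sum_{j,j'} A_{j j'} m_j m_{j'}, as a coefficient vector *)
Definition gram (R : realType) (n d : nat) (A : 'M[R]_((kk n d).+1)) :
  'rV[R]_(NF n d) :=
  \row_(l < NF n d) \sum_(j < (kk n d).+1) \sum_(j' < (kk n d).+1)
     (if addexp (alpha n d j) (alpha n d j') == beta n d l then A j j' else 0).

Definition hpoly_eval (K : comNzRingType) (N e : nat) (c : seq nat -> K)
  (z : 'rV[K]_N) : K :=
  \sum_(a <- mons N e) c a * monom K N a z.

(* Affine cone over H_i in C^{k+1}: nonzero z with
   (z_0,...,z_{n+i}) = (m_0(x),...,m_{n+i}(x)) for some x in C^{n+1}. *)
Definition Hcone (R : realType) (n d i : nat) : set 'rV[R[i]]_((kk n d).+1) :=
  [set z | z != 0 /\ exists x : 'rV[R[i]]_n.+1,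
              forall j : 'I_((kk n d).+1), (j <= n + i)%N -> z ord0 j = mj _ n d j x].

(* Affine cone over the Zariski closure V_i of H_i in P^k(C): nonzero z on
   which every homogeneous polynomial vanishing on H_i vanishes. *)
Definition Vcone (R : realType) (n d i : nat) : set 'rV[R[i]]_((kk n d).+1) :=
  [set z | z != 0 /\ forall (e : nat) (c : seq nat -> R[i]),
      (forall w, Hcone R n d i w -> hpoly_eval _ _ e c w = 0) ->
      hpoly_eval _ _ e c z = 0].

Definition toC (R : realType) (N : nat) (z : 'rV[R]_N) : 'rV[R[i]]_N :=
  \row_(l < N) Complex (z ord0 l) 0.

(* Real points of V_i (representatives in R^{k+1} \ 0). *)
Definition Vreal (R : realType) (n d i : nat) : set 'rV[R]_((kk n d).+1) :=
  [set z | Vcone R n d i (toC R _ z)].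

Definition qform (R : realType) (N : nat) (A : 'M[R]_N) (z : 'rV[R]_N) : R :=
  (z *m A *m z^T) ord0 ord0.

Definition Ccone (R : realType) (n d i : nat) : set 'rV[R]_(NF n d) :=
  [set f | exists A : 'M[R]_((kk n d).+1),
     A^T = A /\ gram R n d A = f /\ (forall z, Vreal R n d i z -> 0 <= qform R _ A z)].

(* Main.v *)
Require Import Defs.
From HB Require Import structures.
From mathcomp Require Import all_boot all_order all_algebra.
From mathcomp Require Import all_classical all_reals all_analysis.
From mathcomp Require Import complex.
From mathcomp Require Import ring lra.
Import numFieldNormedType.Exports.
Import Order.TTheory GRing.Theory Num.Theory.
Local Open Scope ring_scope.
Local Open Scope classical_set_scope.

(* [C_i] is the image under the linear Gram map of the closed convex cone [P_i]
   of symmetric [A] with [q_A >= 0] on [V_i(R)]. By compactness of the unit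
   sphere of a complement, such an image is closed as soon as every [A] in
   [P_i] with [G(A) = 0] also has [-A] in [P_i]. For such an [A] and a real
   point [x], the coordinates of index [k > n + i] are free on [H_i], so
   [t |-> q_A(m(x) + t e_k)] is a nonnegative quadratic polynomial vanishing
   at [0]; hence [sum_j A_kj m_j(x) = 0] for all [x], and [A_kj = 0] because
   monomials are linearly independent. Thus [q_A] only involves
   [z_0, ..., z_(n+i)], so it equals [G(A)(x) = 0] on [H_i], and it vanishes on
   the Zariski closure [V_i]. *)

(** * Enumeration and number of exponent vectors *)

Lemma monsS v dg : mons v.+1 dg =
  [seq a :: t | a <- rev (iota 0 dg.+1), t <- mons v (dg - a)].
Proof. by []. Qed.

Lemma mem_mons v dg a : (a \in mons v dg) = (size a == v) && (sumn a == dg).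
Proof.
elim: v dg a => [|v IH] dg a; first by case: dg a => [|dg] [|[|b] a].
rewrite monsS.
apply/allpairsPdep/idP => [[b [t [Hb Ht ->]]]|].
  move: Hb Ht; rewrite mem_rev mem_iota ltnS IH /= eqSS => Hb /andP[-> /eqP->].
  by rewrite /= subnKC.
case: a => // b t /andP[st /eqP <-].
exists b, t; split=> //; first by rewrite mem_rev mem_iota add0n ltnS /= leq_addr.
by rewrite IH -eqSS st addKn eqxx.
Qed.

Lemma uniq_mons v dg : uniq (mons v dg).
Proof.
elim: v dg => [|v IH] dg; first by case: dg.
rewrite monsS.
apply: allpairs_uniq_dep => [|a _|]; rewrite ?rev_uniq ?iota_uniq ?IH //.
by move=> [a s] [b t] _ _ /= [-> ->].
Qed.

(** Splitting by the first exponent leaves the sum of ['C(n + b, n)] over [b <= dg], which Pascal's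
    rule adds up by induction on [dg]. *)
Lemma size_mons n dg : size (mons n.+1 dg) = 'C(n + dg, n).
Proof.
elim: n dg => [|n IHn] dg.
  rewrite monsS size_allpairs_dep map_rev sumn_rev sumnE big_map.
  rewrite -[iota 0 dg.+1]/(index_iota 0 dg.+1) big_nat_recr //= subnn bin0.
  rewrite big_nat big1 // => b /andP[_ bd].
  by rewrite -[(dg - b)%N]prednK ?subn_gt0.
have -> : size (mons n.+2 dg) = (\sum_(b < dg.+1) 'C(n + b, n))%N.
  rewrite monsS size_allpairs_dep map_rev sumn_rev sumnE.
  rewrite big_map -[iota 0 dg.+1]/(index_iota 0 dg.+1) big_mkord.
  rewrite (reindex_inj rev_ord_inj); apply: eq_bigr => b _ /=.
  by rewrite subSS subKn ?IHn // -ltnS.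
elim: dg => [|dg IHd]; first by rewrite big_ord1 !addn0 !binn.
by rewrite big_ord_recr /= IHd addSnnS [in RHS]addSn binS.
Qed.

Lemma size_mons_kk n d : size (mons n.+1 d) = (kk n d).+1.
Proof. by rewrite size_mons prednK // bin_gt0 leq_addr. Qed.

Lemma alpha_mem n d j : (j < (kk n d).+1)%N -> alpha n d j \in mons n.+1 d.
Proof. by move=> jk; rewrite mem_nth // size_mons_kk. Qed.

Lemma alpha_inj n d (j j' : 'I_(kk n d).+1) : alpha n d j = alpha n d j' -> j = j'.
Proof.
move/eqP; rewrite nth_uniq ?uniq_mons ?size_mons_kk // => /eqP.
exact: val_inj.
Qed.

Lemma addexp_mem v e e' a b :
  a \in mons v e -> b \in mons v e' -> addexp a b \in mons v (e + e').
Proof.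
rewrite !mem_mons => /andP[/eqP sa /eqP <-] /andP[/eqP sb /eqP <-].
rewrite size_map size_zip sa sb minnn eqxx /=.
elim: a b v sa sb => [|x a IH] [|y b] v //= <- // [sab].
by rewrite (eqP (IH b (size a) _ _)) // addnACA.
Qed.

(** * Products and linear independence of monomials *)

Lemma monom_addexp (K : comNzRingType) v (a b : seq nat) (x : 'rV[K]_v) :
  size a = v -> size b = v ->
  monom K v (addexp a b) x = monom K v a x * monom K v b x.
Proof.
move=> sa sb; rewrite /monom -big_split; apply: eq_bigr => l _ /=.
rewrite (nth_map (0%N, 0%N)) ?size_zip ?sa ?sb ?minnn // nth_zip ?sa ?sb //=.
by rewrite exprD.
Qed.

(* Kronecker substitution: base-[B] digits separate exponent vectors. *)
Lemma digits_inj B v (a b : seq nat) : size a = v -> size b = v ->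
  all (fun x => x < B)%N a -> all (fun x => x < B)%N b ->
  (\sum_(l < v) B ^ l * nth 0 a l)%N = (\sum_(l < v) B ^ l * nth 0 b l)%N -> a = b.
Proof.
elim: v a b => [|v IH] [|x a] [|y b] //= [sa] [sb] /andP[xB aB] /andP[yB bB].
rewrite !big_ord_recl /= !expn0 !mul1n.
have E (c : seq nat) : (\sum_(i < v) B ^ bump 0 i * nth 0 c i =
    (\sum_(i < v) B ^ i * nth 0 c i) * B)%N.
  rewrite big_distrl; apply: eq_bigr => i _.
  by rewrite /bump /= add1n expnS -mulnA mulnC.
rewrite !E => H.
have xy : x = y.
  by move: (congr1 (modn^~ B) H); rewrite /= ![(_ + _ * B)%N]addnC !modnMDl !modn_small.
move: H; rewrite xy => /addnI /eqP; rewrite eqn_pmul2r; last first.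
  exact: leq_ltn_trans yB.
by move=> /eqP /IH -> .
Qed.

(** Under x_l = t^(B^l) the monomials become distinct powers of t, so the [c j] are coefficients of
    a univariate polynomial that vanishes at every real t. *)
Lemma monom_free (R : realType) v dg N (s : 'I_N -> seq nat) (c : 'I_N -> R) :
  injective s -> (forall j, s j \in mons v dg) ->
  (forall x : 'rV[R]_v, \sum_j c j * monom R v (s j) x = 0) -> forall j, c j = 0.
Proof.
move=> s_inj s_mem c0.
have szs j : size (s j) = v by have := s_mem j; rewrite mem_mons => /andP[/eqP].
pose B := dg.+1.
pose code j := (\sum_(l < v) B ^ l * nth 0 (s j) l)%N.
have bound j : all (fun x => x < B)%N (s j).
  have := s_mem j; rewrite mem_mons /B => /andP[_ /eqP <-].
  elim: (s j) => //= x a IH; rewrite ltnS leq_addr /=.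
  by apply: sub_all IH => y; rewrite !ltnS => /leq_trans -> //; rewrite leq_addl.
have code_inj : injective code.
  by move=> j j' E; apply/s_inj/(@digits_inj B v).
pose p : {poly R} := \sum_j c j *: 'X^(code j).
have px t : p.[t] = 0.
  rewrite -(c0 (\row_l t ^+ (B ^ l))) horner_sum; apply: eq_bigr => j _.
  rewrite hornerZ hornerXn /monom; congr (_ * _).
  rewrite expr_sum; apply: eq_bigr => l _.
  by rewrite mxE exprM.
have p0 : p = 0.
  apply/eqP; case: eqVneq => // pN0.
  (* The naturals below [size p] already give more distinct roots than a nonzero [p] can have. *)
  have natR_inj : injective (fun k => k%:R : R).
    by move=> a b /eqP; rewrite eqr_nat => /eqP.
  have := max_poly_roots pN0 _ (mkseq_uniq (size p) natR_inj).
  rewrite size_mkseq ltnn; apply.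
  by apply/allP => t _; apply/rootP.
move=> j; have := coef0 R (code j); rewrite -p0 coef_sum (bigD1 j) //=.
rewrite coefZ coefXn eqxx mulr1 big1 ?addr0 // => j' j'j.
by rewrite coefZ coefXn (inj_eq code_inj) eq_sym (negPf j'j) mulr0.
Qed.

(** * Evaluation of quadratic forms and of the Gram map *)

Lemma big_seq_delta (K : comNzRingType) (s : seq (seq nat)) b (t : K)
    (F : seq nat -> K) : uniq s -> b \in s ->
  \sum_(a <- s) (if b == a then t else 0) * F a = t * F b.
Proof.
move=> us bs; rewrite (bigD1_seq b) //= eqxx big1 ?addr0 // => a ab.
by rewrite eq_sym (negPf ab) mul0r.
Qed.

Lemma qformE (R : realType) N (A : 'M[R]_N) z :
  qform R N A z = \sum_j \sum_j' A j j' * (z ord0 j * z ord0 j').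
Proof.
rewrite /qform mxE exchange_big; apply: eq_bigr => j' _.
rewrite !mxE big_distrl; apply: eq_bigr => j _ /=.
by rewrite mulrCA mulrA.
Qed.

(** The products m_j m_j' are collected by exponent. The morphism [f] lets one identity serve both
    real points and, through [real_complex], complex ones. *)
Lemma gram_eval (R : realType) n d (A : 'M[R]_((kk n d).+1)) (K : comNzRingType)
    (f : {rmorphism R -> K}) (x : 'rV[K]_n.+1) :
  \sum_(l < NF n d) f (gram R n d A ord0 l) * monom K n.+1 (beta n d l) x =
  \sum_(j < (kk n d).+1) \sum_(j' < (kk n d).+1)
    f (A j j') * (mj K n d j x * mj K n d j' x).
Proof.
have E l : f (gram R n d A ord0 l) * monom K n.+1 (beta n d l) x =
    \sum_(j < (kk n d).+1) \sum_(j' < (kk n d).+1)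
   (if addexp (alpha n d j) (alpha n d j') == beta n d l then f (A j j') else 0) *
     monom K n.+1 (beta n d l) x.
  rewrite mxE rmorph_sum big_distrl; apply: eq_bigr => j _ /=.
  rewrite rmorph_sum big_distrl; apply: eq_bigr => j' _ /=.
  by case: ifP => _ //; rewrite rmorph0.
under eq_bigr do rewrite E.
rewrite exchange_big; apply: eq_bigr => j _.
rewrite exchange_big; apply: eq_bigr => j' _ /=.
have am (k : 'I_(kk n d).+1) : alpha n d k \in mons n.+1 d := alpha_mem n d k (ltn_ord k).
have sz (k : 'I_(kk n d).+1) : size (alpha n d k) = n.+1.
  by have := am k; rewrite mem_mons => /andP[/eqP].
rewrite -monom_addexp //.
rewrite -(@big_seq_delta _ (mons n.+1 (2 * d)) _ _ (fun a => monom K n.+1 a x));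
  rewrite ?uniq_mons //; last first.
  by rewrite mul2n -addnn; apply: addexp_mem; apply: am.
by rewrite (big_nth [::]) big_mkord.
Qed.

(** * Continuity of linear maps on row vectors *)

Lemma continuous_sum (R : realType) (T : topologicalType) (V : normedModType R)
    (I : Type) (s : seq I) (f : I -> T -> V) :
  (forall i, continuous (f i)) -> continuous (fun x => \sum_(i <- s) f i x).
Proof.
move=> fc; elim: s => [|i s IH] x.
  under eq_fun do rewrite big_nil.
  exact: cvg_cst.
under eq_fun do rewrite big_cons.
by apply: cvgD; [exact: fc | exact: IH].
Qed.

Lemma mulmx_continuous (R : realType) N M (G : 'M[R]_(N, M)) :
  continuous (fun u : 'rV[R]_N => u *m G).
Proof.
under eq_fun do rewrite mulmx_sum_row.
apply: continuous_sum => i x.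
exact: (@cvgZr_tmp _ _ _ _ (nbhs_filter x) _ _ _ (@coord_continuous R 1 N 0 i x)).
Qed.

Lemma norm_mulmx_continuous (R : realType) N M (G : 'M[R]_(N, M)) :
  continuous (fun u : 'rV[R]_N => `|u *m G|).
Proof.
move=> x.
exact: (@cvg_norm _ _ _ _ (nbhs_filter x) _ _ (@mulmx_continuous _ _ _ _ x)).
Qed.

Lemma closed_preimage {T U : topologicalType} (f : T -> U) (D : set U) :
  continuous f -> closed D -> closed (f @^-1` D).
Proof. by move=> fc; apply: preimage_closed => x _; exact: fc. Qed.

(** * Closed linear images of convex cones *)

Lemma subspace_mx (F : fieldType) N (L : 'rV[F]_N -> Prop) :
  L 0 -> (forall u v, L u -> L v -> L (u + v)) ->
  (forall c v, L v -> L (c *: v)) ->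
  exists U : 'M[F]_N, forall v, L v <-> (v <= U)%MS.
Proof.
move=> L0 LD LZ.
(* [U] is chosen of maximal rank among matrices with row space inside [L]; a vector of [L] outside
   that row space would raise the rank. *)
pose Q r := `[< exists U : 'M[F]_N, \rank U = r /\ forall v, (v <= U)%MS -> L v >].
have exQ : exists r, Q r.
  exists 0%N; apply/asboolP; exists 0; rewrite mxrank0; split=> // v.
  by rewrite submx0 => /eqP ->.
have leQ r : Q r -> (r <= N)%N by move=> /asboolP [U [<- _]]; exact: rank_leq_row.
case: (ex_maxnP exQ leQ) => r /asboolP [U [rU UL]] rmax.
exists U => v; split; last exact: UL.
move=> Lv; apply: submx_trans (addsmxSr U v) _.
have [_ <-] := mxrank_leqif_sup (addsmxSl U v).
rewrite eqn_leq mxrankS ?addsmxSl //= rU; apply: rmax; apply/asboolP.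
exists (U + v)%MS; split=> // w /sub_addsmxP [[a b] /= ->].
apply: LD; first by apply: UL; exact: submxMl.
by rewrite [b]mx11_scalar mul_scalar_mx; exact: LZ.
Qed.

(** The elements of [P] killed by [G] form a linear subspace [U]. On the part [K] of [P] inside a
    complement of [U], [G] is bounded below, so a bounded piece of the image comes from a compact
    piece of [K]. *)
Lemma closed_cone_image (R : realType) N M (G : 'M[R]_(N, M)) (P : set 'rV[R]_N) :
  closed P -> P 0 -> (forall u v, P u -> P v -> P (u + v)) ->
  (forall c u, 0 <= c -> P u -> P (c *: u)) ->
  (forall u, P u -> u *m G = 0 -> P (- u)) ->
  closed ((fun u => u *m G) @` P).
Proof.
move=> Pcl P0 PD PZ PN.
have [U UP] : exists U : 'M[R]_N, forall v, (P v /\ v *m G = 0) <-> (v <= U)%MS.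
  apply: subspace_mx => [|u v [Pu u0] [Pv v0]|c v [Pv v0]].
  - by rewrite mul0mx.
  - by rewrite mulmxDl u0 v0 addr0; split=> //; exact: PD.
  - rewrite -scalemxAl v0 scaler0; split=> //.
    have [c0|c0] := leP 0 c; first exact: PZ.
    by rewrite -[c]opprK scaleNr -scalerN; apply: PZ; [rewrite oppr_ge0 ltW|exact: PN].
pose K := [set v | P v /\ (v <= U^C)%MS].
have Kcl : closed K.
  apply: closedI => //.
  (* Membership in the complement is the vanishing of a continuous norm. *)
  rewrite [X in closed X](_ : _ =
      (fun v : 'rV[R]_N => `|v *m cokermx (U^C)%MS|) @^-1` [set x | x = 0]).
    apply: closed_preimage; last exact: closed_eq.
    exact: norm_mulmx_continuous.
  apply/seteqP; split=> v /=; rewrite submxE; first by move=> /eqP ->; rewrite normr0.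
  by move/eqP; rewrite normr_eq0.
have cptB r : compact (K `&` [set v | `|v| <= r]).
  apply: bounded_closed_compact.
    exists r; split; rewrite ?num_real // => x rx v [_ /= vr].
    exact: le_trans vr (ltW rx).
  apply: closedI => //.
  apply: (closed_preimage (fun v : 'rV[R]_N => `|v|) [set x | x <= r]).
    exact: norm_continuous.
  exact: closed_le.
have KN0 v : K v -> v *m G = 0 -> v = 0.
  move=> [Pv vUC] v0; apply/eqP; rewrite -submx0 -(capmx_compl U) sub_capmx vUC.
  by rewrite andbT; apply/UP.
have KZ c v : 0 <= c -> K v -> K (c *: v).
  by move=> c0 [Pv vU]; split; [exact: PZ | exact: scalemx_sub].
(* [c] is the minimum of |v G| on the unit sphere of [K], positive because [G] kills no nonzero
   vector of [K]. *)
have [c c0 cG] : exists2 c, 0 < c & forall v, K v -> c * `|v| <= `|v *m G|.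
  pose S := K `&` [set v | `|v| = 1].
  have Scpt : compact S.
    apply: subclosed_compact (cptB 1) _.
      apply: closedI => //.
      apply: (closed_preimage (fun v : 'rV[R]_N => `|v|) [set x | x = 1]).
        exact: norm_continuous.
      exact: closed_eq.
    by move=> v [Kv /= ->]; split=> //=.
  have KS v : K v -> v != 0 -> S (`|v|^-1 *: v).
    move=> Kv vN0; split; first by apply: KZ; rewrite ?invr_ge0.
    by rewrite /= normrZ normfV normr_id mulVf ?normr_eq0.
  have [S0|SN0] := pselect (S !=set0); last first.
    (* An empty sphere means that [K] contains only 0, so any positive constant will do. *)
    exists 1 => // v Kv; have [->|vN0] := eqVneq v 0; first by rewrite normr0 mulr0.
    by case: SN0; exists (`|v|^-1 *: v); exact: KS.
  have [||w] := @compact_EVT_min _ R (fun v : 'rV[R]_N => `|v *m G|) S S0 => //.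
    by apply: continuous_subspaceT; exact: norm_mulmx_continuous.
  rewrite inE => -[Kw /= w1] wmin; exists `|w *m G|.
    rewrite normr_gt0; apply/eqP => /(KN0 _ Kw) w0.
    by move: w1; rewrite w0 normr0 => /eqP; rewrite eq_sym oner_eq0.
  move=> v Kv; have [->|vN0] := eqVneq v 0; first by rewrite normr0 mulr0.
  have := wmin (`|v|^-1 *: v); rewrite inE => /(_ (KS v Kv vN0)).
  by rewrite -scalemxAl normrZ normfV normr_id mulrC ler_pdivlMr ?normr_gt0.
(* Removing the component in [U] keeps [v] in [P], as [U] is a subspace inside [P], and does not
   change the image. *)
have imK v : P v -> exists2 w, K w & w *m G = v *m G.
  move=> Pv; have /sub_addsmxP [[a b] /= vE] := submx_full v (addsmx_compl_full U).
  have /UP [Pa aG] : (- (a *m U) <= U)%MS by rewrite -mulNmx submxMl.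
  have bE : b *m (U^C)%MS = v + - (a *m U) by rewrite vE addrAC subrr add0r.
  exists (b *m (U^C)%MS); last by rewrite bE mulmxDl aG addr0.
  by split; [rewrite bE; exact: PD | exact: submxMl].
(* Image points within 1 of [f] have norm at most |f| + 1, so their representatives in [K] have norm
   at most [r]. *)
move=> f fcl; pose r := (`|f| + 1) / c.
suff : ((fun u => u *m G) @` (K `&` [set v | `|v| <= r])) f.
  by case=> v [[Pv _] _] <-; exists v.
apply: compact_closed; [exact: norm_hausdorff | |].
  apply: continuous_compact (cptB r).
  by apply: continuous_subspaceT; exact: mulmx_continuous.
move=> B fB; have fB1 : nbhs f (B `&` ball f 1).
  by apply: filterI => //; exact: nbhsx_ballx.
have [_ [[v Pv <-] [Bv fv]]] := fcl _ fB1.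
have [w Kw wG] := imK v Pv.
exists (v *m G); split=> //; exists w => //; split=> //=.
rewrite /r ler_pdivlMr // mulrC; apply: le_trans (cG w Kw) _; rewrite wG.
move: fv; rewrite -ball_normE /= => fv.
rewrite -[v *m G](subrK f) addrC; apply: le_trans (ler_normD _ _) _.
by rewrite lerD2l distrC ltW.
Qed.

(** * Quadratic forms and their values on V_i *)

Lemma quadratic_hpoly (K : comNzRingType) N (A : 'M[K]_N) :
  exists c, forall z, hpoly_eval K N 2 c z =
    \sum_j \sum_j' A j j' * (z ord0 j * z ord0 j').
Proof.
pose e (j : 'I_N) := mkseq (fun l => (l == j) : nat) N.
have eM j : e j \in mons N 1.
  rewrite mem_mons size_mkseq eqxx /= sumnE big_map.
  rewrite -[X in iota 0 X]subn0 -/(index_iota 0 N) big_mkord (bigD1 j) //=.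
  rewrite eqxx big1 // => l lj.
  by rewrite (inj_eq val_inj) (negPf lj).
have eE j z : monom K N (e j) z = z ord0 j.
  rewrite /monom (bigD1 j) //= nth_mkseq // eqxx expr1 big1 ?mulr1 // => l lj.
  by rewrite nth_mkseq // (inj_eq val_inj) (negPf lj) expr0.
(* The coefficient at [a] gathers all pairs with z_j z_j' = z^a; in this format the definition of
   [Vcone] applies to q_A. *)
exists (fun a => \sum_j \sum_j' (if addexp (e j) (e j') == a then A j j' else 0)) => z.
rewrite /hpoly_eval; under eq_bigr do rewrite big_distrl.
rewrite exchange_big; apply: eq_bigr => j _ /=.
under eq_bigr do rewrite big_distrl.
rewrite exchange_big; apply: eq_bigr => j' _ /=.
rewrite (@big_seq_delta _ _ _ _ (fun a => monom K N a z)) ?uniq_mons //.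
  by rewrite monom_addexp ?size_mkseq // !eE.
exact: (addexp_mem _ 1 1).
Qed.

Lemma mj_toC (R : realType) n d j (x : 'rV[R]_n.+1) :
  mj R[i] n d j (toC R _ x) = real_complex R (mj R n d j x).
Proof.
rewrite /mj /monom rmorph_prod; apply: eq_bigr => l _.
by rewrite mxE rmorphXn.
Qed.

Lemma qform_toC (R : realType) N (A : 'M[R]_N) z :
  real_complex R (qform R N A z) =
  \sum_j \sum_j' real_complex R (A j j') * (toC R N z ord0 j * toC R N z ord0 j').
Proof.
rewrite qformE rmorph_sum; apply: eq_bigr => j _.
by rewrite rmorph_sum; apply: eq_bigr => j' _; rewrite !rmorphM !mxE.
Qed.

(** Second-order expansion along a coordinate axis; the symmetry of [A] merges the two cross
    terms. *)
Lemma qform_add_delta (R : realType) N (A : 'M[R]_N) u k t : A^T = A ->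
  qform R N A (u + t *: delta_mx ord0 k) =
  qform R N A u + 2 * t * (\sum_j A k j * u ord0 j) + t ^+ 2 * A k k.
Proof.
move=> AT; set v := delta_mx ord0 k.
have vAu : (v *m A *m u^T) ord0 ord0 = \sum_j A k j * u ord0 j.
  by rewrite -rowE mxE; apply: eq_bigr => j _; rewrite !mxE.
have uAv : (u *m A *m v^T) ord0 ord0 = \sum_j A k j * u ord0 j.
  have -> : u *m A *m v^T = (v *m A *m u^T)^T by rewrite !trmx_mul trmxK AT mulmxA.
  by rewrite mxE.
have vAv : (v *m A *m v^T) ord0 ord0 = A k k.
  by rewrite -rowE /v trmx_delta -colE !mxE.
have mxD (X Y : 'M[R]_1) : (X + Y) ord0 ord0 = X ord0 ord0 + Y ord0 ord0.
  by rewrite mxE.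
have mxZ (X : 'M[R]_1) : (t *: X) ord0 ord0 = t * X ord0 ord0 by rewrite mxE.
have -> : qform R N A (u + t *: v) = (u *m A *m u^T) ord0 ord0 +
    t * (u *m A *m v^T) ord0 ord0 +
    (t * (v *m A *m u^T) ord0 ord0 + t * (t * (v *m A *m v^T) ord0 ord0)).
  rewrite /qform [(_ + _)^T]linearD /= [(t *: _)^T]linearZ /=.
  by rewrite !mulmxDl !mulmxDr -!scalemxAl -!scalemxAr !mxD !mxZ.
by rewrite vAu uAv vAv /qform; ring.
Qed.

(** With s = 1 / (|a| + 1), the choice t = - b s gives b^2 s (s a - 2), which is negative for
    nonzero b because s a < 1. *)
Lemma nonneg_quadratic (R : realType) (a b : R) :
  (forall t, 0 <= 2 * t * b + t ^+ 2 * a) -> b = 0.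
Proof.
move=> H; have [//|bN0] := eqVneq b 0.
have b2 : 0 < b ^+ 2 by rewrite exprn_even_gt0.
pose s := (`|a| + 1)^-1.
have s0 : 0 < s by rewrite invr_gt0 ltr_wpDl.
have s1 : s * (`|a| + 1) = 1 by rewrite mulVf // gt_eqF // ltr_wpDl.
have sa : s * a <= s * `|a| by rewrite ler_pM2l // ler_norm.
have := H (- b * s).
rewrite (_ : _ + _ = (b ^+ 2 * s) * (s * a - 2)); last by ring.
have bs0 : 0 < b ^+ 2 * s by exact: mulr_gt0.
by rewrite pmulr_rge0 // => ?; lra.
Qed.

(** This supplies the kernel hypothesis of [closed_cone_image]: a form vanishing on V_i(R) may
    change sign. *)
Lemma qform_vanish (R : realType) n d i (A : 'M[R]_((kk n d).+1)) : A^T = A ->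
  (forall z, Vreal R n d i z -> 0 <= qform R _ A z) -> gram R n d A = 0 ->
  forall z, Vreal R n d i z -> qform R _ A z = 0.
Proof.
move=> AT A0 GA.
(* q_A vanishes at every monomial vector; this serves over the reals to kill rows of [A], and over
   the complex numbers on H_i. *)
have AmE (K : comNzRingType) (f : {rmorphism R -> K}) x :
    \sum_j \sum_j' f (A j j') * (mj K n d j x * mj K n d j' x) = 0.
  rewrite -gram_eval big1 // => l _.
  by rewrite GA mxE rmorph0 mul0r.
have Arow (k j : 'I_(kk n d).+1) : (n + i < k)%N -> A k j = 0.
  move=> ik; apply: (@monom_free R n.+1 d _ (fun j : 'I_(kk n d).+1 => alpha n d j)
    (A k)) => [||x].
  - exact: alpha_inj.
  - by move=> j'; exact: alpha_mem.
  pose u := \row_(j' < (kk n d).+1) mj R n d j' x.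
  have qu : qform R _ A u = 0.
    rewrite qformE -[RHS](AmE R idfun x). apply: eq_bigr => j1 _.
    by apply: eq_bigr => j2 _; rewrite !mxE.
  (* The value at u + t e_k is nonnegative with constant term 0, so its linear coefficient, a
     combination of monomials in [x], vanishes. *)
  rewrite -[RHS](@nonneg_quadratic R (A k k) (\sum_j' A k j' * u ord0 j')).
    by apply: eq_bigr => j' _; rewrite mxE.
  (* Moving along a free coordinate [k] stays in the fibre of [H_i] over [x]. *)
  move=> t; rewrite -[_ + _]add0r -[X in X + _]qu addrA -qform_add_delta //.
  (* Points of [Vcone] are nonzero, so [w = 0] is settled apart, where q_A is 0. *)
  set w := _ + _; have [->|wN0] := eqVneq w 0.
    by rewrite /qform !mul0mx mxE.
  have wC : toC R _ w != 0.
    apply: contra wN0 => /eqP w0; apply/eqP/rowP => l.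
    by have := congr1 (fun v : 'rV[R[i]]_(kk n d).+1 => v ord0 l) w0; rewrite !mxE => -[].
  apply: A0; have Hw : Hcone R n d i (toC R _ w).
    split.
      (* [z != 0] in [Hcone] elaborates to an inequality of functions, not of matrices. *)
      by apply: contra wC => /eqP w0; apply/eqP/matrixP => a l; rewrite w0 mxE.
    exists (toC R _ x) => l li; rewrite mj_toC !mxE eqxx /=.
    (* Since l <= n + i < k, the shift along [k] leaves coordinate [l] unchanged. *)
    rewrite (_ : (l == k) = false) ?mulr0 ?addr0 //; apply/negP => /eqP lk.
    by move: li; rewrite lk leqNgt ik.
  by split=> // e c; apply.
have Acol (k j : 'I_(kk n d).+1) : (n + i < k)%N -> A j k = 0.
  by move=> ik; rewrite -AT mxE Arow.
move=> z [_ Vz].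
(* Complexified, q_A is a form of degree 2, so its vanishing on H_i passes to the closure. *)
have [c cE] := quadratic_hpoly _ _ (map_mx (real_complex R) A).
suff : real_complex R (qform R _ A z) = 0 by case.
rewrite qform_toC -[RHS](Vz 2 c) ?cE.
  by apply: eq_bigr => j _; apply: eq_bigr => j' _; rewrite [in RHS]mxE.
move=> w [_ [x wx]]; rewrite cE -[RHS](AmE _ (real_complex R) x).
apply: eq_bigr => j _; apply: eq_bigr => j' _; rewrite mxE.
(* Terms with an index beyond n + i have coefficient 0; in the others the coordinates of [w] are
   monomials in [x]. *)
have [ji|ij] := leqP j (n + i); last by rewrite Arow // rmorph0 !mul0r.
have [ji'|ij'] := leqP j' (n + i); last by rewrite Acol // rmorph0 !mul0r.
by rewrite !wx.
Qed.

(** * Linearity of the Gram map and closedness of C_i *)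

Lemma gram_is_linear (R : realType) n d : linear (gram R n d).
Proof.
move=> c A B; apply/rowP => l; rewrite !mxE big_distrr -big_split.
apply: eq_bigr => j _; rewrite big_distrr -big_split; apply: eq_bigr => j' _ /=.
by case: ifP; rewrite ?mulr0 ?addr0 // !mxE.
Qed.

HB.instance Definition _ (R : realType) n d :=
  GRing.isLinear.Build R _ _ _ (gram R n d) (gram_is_linear R n d).

Theorem theorem2p1 (R : realType) (n d : nat) :
  (1 <= n)%N -> (1 <= d)%N ->
  forall i : nat, (i <= kk n d - n)%N -> closed (Ccone R n d i : set 'rV[R]_(NF n d)).
Proof.
move=> _ _ i _.
set N := (kk n d).+1.
(* Matrices are flattened to row vectors, so that the Gram map becomes right multiplication by
   [G]. *)
pose P := [set v : 'rV[R]_(N * N) | (vec_mx v)^T = vec_mx v /\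
  forall z, Vreal R n d i z -> 0 <= qform R N (vec_mx v) z].
pose G := lin1_mx (gram R n d \o vec_mx).
have GE v : v *m G = gram R n d (vec_mx v) by rewrite mul_rV_lin1.
rewrite (_ : Ccone R n d i = (fun v => v *m G) @` P); last first.
  apply/seteqP; split=> f.
    move=> [A [AT [<- A0]]]; exists (mxvec A); last by rewrite GE mxvecK.
    by rewrite /P /= mxvecK.
  by move=> [v [vT v0] <-]; exists (vec_mx v); rewrite GE.
have entryc (j j' : 'I_N) : continuous (fun v : 'rV[R]_(N * N) => vec_mx v j j').
  rewrite [X in continuous X](_ : _ = fun v : 'rV[R]_(N * N) => v ord0 (mxvec_index j j')).
    exact: coord_continuous.
  by apply/funext => v; rewrite mxE.
apply: closed_cone_image.
- apply: closedI.
    (* Symmetry is an intersection of zero sets of differences of entries. *)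
    rewrite [X in closed X](_ : _ = \bigcap_(p in [set: 'I_N * 'I_N])
      (fun v => vec_mx v p.2 p.1 - vec_mx v p.1 p.2) @^-1` [set x | x = 0]).
      apply: closed_bigI => p _; apply: closed_preimage; last exact: closed_eq.
      by move=> v; exact: (cvgB (entryc _ _ v) (entryc _ _ v)).
    apply/seteqP; split=> v /=.
      by move=> vT p _ /=; rewrite -[in X in X - _]vT [_^T _ _]mxE subrr.
    move=> vT; apply/matrixP => j j'; rewrite mxE.
    by apply/eqP; rewrite -subr_eq0; apply/eqP; exact: (vT (j, j')).
  (* For each fixed [z], q_A(z) is continuous in [A], so every [z] contributes a closed
     condition. *)
  apply: (@closed_bigI _ _ (Vreal R n d i)
    (fun z => (fun v => qform R N (vec_mx v) z) @^-1` [set x | 0 <= x])) => z _.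
  apply: closed_preimage; last exact: closed_ge.
  under eq_fun do rewrite qformE.
  apply: (@continuous_sum R _ R^o) => j; apply: (@continuous_sum R _ R^o) => j' v.
  exact: (cvgM (entryc j j' v) (cvg_cst _)).
- by rewrite /P /= !linear0; split=> // z _; rewrite /qform mulmx0 mul0mx mxE.
- move=> u v [uT u0] [vT v0]; split; first by rewrite !linearD /= uT vT.
  by move=> z Vz; rewrite linearD /qform mulmxDr mulmxDl mxE addr_ge0 ?u0 ?v0.
- move=> c v c0 [vT v0]; split; first by rewrite !linearZ /= vT.
  by move=> z Vz; rewrite linearZ /qform -scalemxAr -scalemxAl mxE mulr_ge0 ?v0.
- move=> v [vT v0]; rewrite GE => Gv; split; first by rewrite !linearN /= vT.
  move=> z Vz; rewrite linearN /qform mulmxN mulNmx mxE.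
  by have := qform_vanish _ _ _ _ _ vT v0 Gv _ Vz; rewrite /qform => ->; rewrite oppr0.
Qed.
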